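(* (1) Let $E$ be a non-zero Banach space, let $*\in\mathrm{Mltp}_{\mathrm{u}}(E)$, and let $a\in\mathrm{Inv}(E,* )$. Suppose that $\diamond\in\mathrm{Mltp}(E)$ is such that $|\diamond-*|<\left(\|a\|\,\|a^{-1}_*\|\,|*|\right)^{-1}$. Then $\diamond$ is unital and $a\in\mathrm{Inv}(E,\diamond)$. (2) Moreover, for every $M>0$ there exists a universal constant $C_M>0$ (depending only on $M$) such that the following holds: for every non-zero Banach space $E$, every $*\in\mathrm{Mltp}_{\mathrm{u}}(E)$, every $a\in\mathrm{Inv}(E,* )$, every $\diamond\in\mathrm{Mltp}(E)$ and every real $r$ with $0\leq r<1$, if $$|*|\leq M,\quad \|e_*\|\leq M,\quad \|a\|\leq M,\quad \|a_*^{-1}\|\leq M\quad\text{and}\quad|\diamond-*|\leq rM^{-3},$$ then $\diamond$ is unital, $a\in\mathrm{Inv}(E,\diamond)$, and $$\|a^{-1}_\diamond-a^{-1}_*\|\leq s^2\,C_M\,|\diamond-*|,\qquad\text{where } s=1+r(1-r)^{-1}.$$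
   Context: $\mathrm{B}_2(E)$ is the Banach space of bounded bilinear maps $E\times E\to E$ with the operator norm $|\varphi|=\sup\{\|\varphi(x,y)\|:\|x\|\leq1,\|y\|\leq1\}$. $\mathrm{Mltp}(E)\subset\mathrm{B}_2(E)$ is the set of continuous multiplications on $E$, i.e. of those $*\in\mathrm{B}_2(E)$ that are associative as binary operations on $E$. $\mathrm{Mltp}_{\mathrm{u}}(E)\subset\mathrm{Mltp}(E)$ is the subset of unital ones, i.e. those for which $(E,* )$ has a (two-sided) unit element, denoted $e_*$. For unital $*$, $\mathrm{Inv}(E,* )$ is the set of invertible elements of $(E,* )$, and $a^{-1}_*$ is the inverse of $a\in\mathrm{Inv}(E,* )$ with respect to $*$. *)

(* Defs.v *)
From HB Require Import structures.
From mathcomp Require Import all_boot all_order all_algebra.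
From mathcomp Require Import sesquilinear complex.
From mathcomp Require Import all_classical all_reals all_analysis.

Set Implicit Arguments.
Unset Strict Implicit.
Unset Printing Implicit Defensive.

Import Order.TTheory GRing.Theory Num.Theory.
Import numFieldNormedType.Exports.

Local Open Scope classical_set_scope.
Local Open Scope ring_scope.

(* The scalar field K is R or R[i]; iota is the inclusion of the reals. It is
   needed because norms in a normedModType K are elements of K, so that over
   R[i] a norm is a nonnegative real complex number. *)
Variant real_or_complex (R : realType) :
    forall K : numFieldType, (R -> K) -> Prop :=
  | real_scalars : @real_or_complex R R id
  | complex_scalars : @real_or_complex R R[i] (@real_complex R).

Section Multiplications.
Variables (K : numFieldType) (E : completeNormedModType K).
Implicit Types (f m : E -> E -> E) (a e : E).

Definition unit_ball_values f : set E :=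
  [set f x y | x in [set x | `|x| <= 1] & y in [set y | `|y| <= 1]].

Definition B2 : set (E -> E -> E) :=
  [set f | bilinear_for *:%R *:%R f /\ bounded_set (unit_ball_values f)].

(* For K = R this is the library's sup. Over R[i] the order is partial
   (x <= y iff y - x is a nonnegative real), but a nonempty bounded set of
   norms still has a least upper bound there, namely its real supremum. *)
Definition opnorm f : K := supremum 0 [set `|v| | v in unit_ball_values f].

Definition Mltp : set (E -> E -> E) := [set m | B2 m /\ associative m].

Definition is_unit m e : Prop := left_id e m /\ right_id e m.

Definition Mltp_u : set (E -> E -> E) :=
  [set m | Mltp m /\ exists e, is_unit m e].

(* Arbitrary (zero) if m has no unit. *)
Definition unit_of m : E := xget 0 [set e | is_unit m e].

Definition is_inverse m a b : Prop := m a b = unit_of m /\ m b a = unit_of m.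

(* Only meaningful for unital m. *)
Definition Invertibles m : set E := [set a | exists b, is_inverse m a b].

(* Arbitrary (zero) if a is not invertible. *)
Definition inv_of m a : E := xget 0 [set b | is_inverse m a b].

End Multiplications.

Arguments B2 {K} E.
Arguments Mltp {K} E.
Arguments Mltp_u {K} E.

(* Main.v *)
Require Import Defs.
From HB Require Import structures.
From mathcomp Require Import all_boot all_order all_algebra.
From mathcomp Require Import sesquilinear complex.
From mathcomp Require Import all_classical all_reals all_analysis.
From mathcomp Require Import ring.
Import Order.TTheory GRing.Theory Num.Theory.
Import numFieldNormedType.Exports.
Local Open Scope classical_set_scope.
Local Open Scope ring_scope.

(** Write [e] for the unit of [m] and [b] for the [m]-inverse of [a]. Left
    [m]-multiplication by [a] is a bijection with inverse left
    [m]-multiplication by [b], and left [d]-multiplication by [a] differs from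
    it by the operator [(d - m) a], of norm at most [|d - m| |a|]. When
    [q = |m| |b| |d - m| |a| < 1], a Neumann series in the complete space [E]
    shows that left [d]-multiplication by [a] is still surjective
    ([perturbed_surjective]), and likewise on the right.

    Associativity of [d] does the rest: in any semigroup, an element whose left
    and right multiplications are both surjective forces the existence of a
    unit and is invertible ([unital_of_surjective_mul]). This gives part (1).

    For part (2), the same perturbation bound is quantitative:
    [(1 - q) |x| <= |m b (d a x)|] ([perturbed_expanding]). Applied to
    [x = e_d - e], where [d a x = a - d a e = (m - d) a e], it bounds
    [|e_d - e|] by [s M^4 |d - m|], with [s = (1 - r)^-1]. Applied to
    [x = b_d - b], where [d a x = (e_d - e) + (m - d) a b], it bounds
    [|b_d - b|] by [s M^2 (s M^4 + M^2) |d - m|]. As [1 <= s], this is at most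
    [s^2 C |d - m|] with [C = M^6 + M^4].

    Norms take their values in the scalar field, whose order is only partial
    over [R[i]]. The argument uses the real numbers through two facts valid in
    both cases: a bounded nonempty set of nonnegative scalars has a supremum
    ([nonneg_supremums_neq0]), and [q ^+ n] tends to [0] when [0 <= q < 1]
    ([geometric_eventually_small]). *)

(** * Nonnegative scalars *)

(** Every nonnegative scalar is the image of a real number, so order-theoretic
    facts about [R] transfer to norms along this order embedding. *)
Lemma real_or_complex_embedding {R : realType} {K : numFieldType}
    {iota : R -> K} : real_or_complex iota ->
  exists f : {rmorphism R -> K}, [/\ iota = f,
    {mono f : x y / x <= y} & forall x, 0 <= x -> exists r, x = f r].
Proof.
case.
  by exists idfun; split=> // x _; exists x.
exists (@real_complex R); split=> // [x y|x].
  exact: lecR.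
rewrite lecE => /andP[/eqP x_im _]; exists (complex.Re x).
by case: x x_im => u v /= ->.
Qed.

Lemma geometric_eventually_small {R : realType} {K : numFieldType}
    {iota : R -> K} {q c e : K} : real_or_complex iota ->
  0 <= q -> q < 1 -> 0 <= c -> 0 < e -> exists N : nat, q ^+ N * c < e.
Proof.
move=> /real_or_complex_embedding[f [_ fle fonto]] q0 q1 c0 e0.
have flt := leW_mono fle.
have [q' qE] := fonto _ q0; have [c' cE] := fonto _ c0.
have [e' eE] := fonto _ (ltW e0); subst q c e.
rewrite -(rmorph0 f) fle in q0; rewrite -(rmorph1 f) flt in q1.
rewrite -(rmorph0 f) fle in c0; rewrite -(rmorph0 f) flt in e0.
have := @cvg_geometric R c' q'; rewrite ger0_norm // => /(_ q1).
move=> /cvgrPdist_lt /(_ e' e0) [N _ /(_ N (leqnn N))] /=.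
rewrite sub0r normrN ger0_norm ?mulr_ge0 ?exprn_ge0 // => small.
by exists N; rewrite -rmorphXn -rmorphM flt mulrC.
Qed.

Lemma nonneg_supremums_neq0 {R : realType} {K : numFieldType}
    {iota : R -> K} {A : set K} : real_or_complex iota ->
  A !=set0 -> (forall x, A x -> 0 <= x) -> ubound A !=set0 ->
  supremums A !=set0.
Proof.
move=> /real_or_complex_embedding[f [_ fle fonto]] [x0 Ax0] A0 [u uA].
(* An upper bound of A dominates a nonnegative scalar, hence is itself
   nonnegative and comes from R. *)
have lift y : ubound A y -> exists s, y = f s.
  by move=> yA; apply: fonto; apply: le_trans (yA _ Ax0); apply: A0.
have [t tE] := lift _ uA; pose B := f @^-1` A.
have ubB v : ubound A (f v) -> ubound B v by move=> vA s /vA; rewrite fle.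
have B_sup : has_sup B.
  split; last by exists t; apply: ubB; rewrite -tE.
  by have [r rE] := fonto _ (A0 _ Ax0); exists r; rewrite /B /= -rE.
exists (f (sup B)); split=> [y Ay|y yA].
  have [s sE] := fonto _ (A0 _ Ay); rewrite sE fle.
  by apply: sup_upper_bound => //; rewrite /B /= -sE.
have [s sE] := lift _ yA; rewrite sE fle; apply: ge_sup; first exact: B_sup.1.
by apply: ubB; rewrite -sE.
Qed.


(** * The operator norm of a bounded bilinear map *)

Section OperatorNorm.
Context {R : realType} {K : numFieldType} {iota : R -> K}.
Context {E : completeNormedModType K}.
Hypothesis hK : real_or_complex iota.
Implicit Types (f g : E -> E -> E) (x y : E).

Lemma opnorm_ub {f x y} : B2 E f -> `|x| <= 1 -> `|y| <= 1 ->
  `|f x y| <= opnorm f.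
Proof.
move=> [_ [M [_ fM]]] x1 y1.
set A := [set `|v| | v in unit_ball_values f].
have Axy : A `|f x y| by exists (f x y) => //; exists x => //; exists y.
have [s sA] : supremums A !=set0.
  apply: (nonneg_supremums_neq0 hK).
  - by exists `|f x y|.
  - by move=> _ [v _ <-].
  - by exists (M + 1) => _ [v vf <-]; apply: (fM (M + 1)) => //; rewrite ltrDl.
rewrite /opnorm -/A /supremum; case: ifPn => [/eqP A0|_].
  by rewrite A0 in Axy.
have [+ _] := xgetPex 0 (ex_intro _ s sA); exact.
Qed.

Lemma opnorm_ge0 {f} : B2 E f -> 0 <= opnorm f.
Proof.
by move=> fB; apply: le_trans (@opnorm_ub f 0 0 fB _ _); rewrite ?normr0.
Qed.

(** The defining estimate of the operator norm, in a form that composes: each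
    factor is replaced by an upper bound. By homogeneity it reduces to
    [opnorm_ub], a nonzero vector being its norm times a unit vector. *)
Lemma opnorm_le {f x y c s t} : B2 E f ->
  opnorm f <= c -> `|x| <= s -> `|y| <= t -> `|f x y| <= c * (s * t).
Proof.
move=> fB fc xs yt.
suff: `|f x y| <= opnorm f * (`|x| * `|y|).
  move=> /le_trans; apply; apply: ler_pM => //; last exact: ler_pM.
  exact: opnorm_ge0.
have fl z := scalable_linear (fB.1.1 z).
have fr z := scalable_linear (fB.1.2 z).
have unitize (z : E) : exists2 w, `|w| <= 1 & z = `|z| *: w.
  have [->|z0] := eqVneq z 0; first by exists 0; rewrite ?normr0 // scaler0.
  exists (`|z|^-1 *: z); last by rewrite scalerA divff ?normr_eq0 // scale1r.
  by rewrite normrZ normfV normr_id mulVf ?normr_eq0.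
have [v v1 xE] := unitize x; have [w w1 yE] := unitize y.
rewrite [in leLHS]xE fl /= [in leLHS]yE fr /= !normrZ !normr_id mulrA mulrC.
by apply: ler_wpM2r; [exact: mulr_ge0|exact: opnorm_ub].
Qed.

Lemma B2B {f g} : B2 E f -> B2 E g -> B2 E (f - g).
Proof.
move=> fB gB; split; first split.
- move=> y k u v; rewrite /= !fctE fB.1.1 gB.1.1 /=.
  by rewrite scalerBr opprD addrACA.
- move=> x k u v; rewrite /= !fctE fB.1.2 gB.1.2 /=.
  by rewrite scalerBr opprD addrACA.
exists (opnorm f + opnorm g); split.
  by rewrite ger0_real // addr_ge0 // opnorm_ge0.
move=> c /ltW fgc _ [x x1 [y y1 <-]] /=; apply: le_trans fgc.
rewrite !fctE (le_trans (ler_normB _ _)) //.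
by apply: lerD; apply: opnorm_ub.
Qed.

End OperatorNorm.

(** * Perturbation of invertible operators *)

Section Neumann.
Context {R : realType} {K : numFieldType} {iota : R -> K}.
Context {E : completeNormedModType K}.
Hypothesis hK : real_or_complex iota.

(** The solution is the sum of the series of iterates [g^k y], dominated by a
    geometric series. *)
Lemma neumann_surjective {g : E -> E} {q : K} : zmod_morphism g ->
  0 <= q -> q < 1 -> (forall x, `|g x| <= q * `|x|) ->
  forall y, exists x, x - g x = y.
Proof.
move=> gB q0 q1 gq y.
pose G : {additive E -> E} := HB.pack g (GRing.isZmodMorphism.Build E E g gB).
pose u k := iter k g y.
have uq k : `|u k| <= q ^+ k * `|y|.
  elim: k => [|k IH]; first by rewrite mul1r.
  by rewrite exprS -mulrA; apply: le_trans (gq _) _; apply: ler_wpM2l.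
have q1' : 0 < 1 - q by rewrite subr_gt0.
have tail i j : `|\sum_(i <= k < j) u k| <= q ^+ i * (`|y| / (1 - q)).
  have c0 : 0 <= `|y| / (1 - q) by rewrite divr_ge0 // ltW.
  have [ij|/ltnW ji] := leqP i j; last first.
    by rewrite big_geq // normr0 mulr_ge0 ?exprn_ge0.
  apply: le_trans (_ : (q ^+ i - q ^+ j) * (`|y| / (1 - q)) <= _); last first.
    by rewrite ler_wpM2r // gerBl exprn_ge0.
  apply: le_trans (ler_norm_sum _ _ _) _.
  rewrite -(opprB (q ^+ j)) -(telescope_sumr (fun k => q ^+ k)) //.
  rewrite -sumrN big_distrl; apply: ler_sum => k _; rewrite opprB exprS.
  rewrite -{1}[q ^+ k]mul1r -mulrBl [leRHS]mulrC mulrA.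
  by rewrite divfK ?gt_eqF // [leRHS]mulrC.
have /cauchy_cvgP Su : cauchy (series u @ \oo).
  apply/cauchy_seriesP => e e0.
  have c0 : 0 <= `|y| / (1 - q) by rewrite divr_ge0 // ltW.
  have [N Ne] := geometric_eventually_small hK q0 q1 c0 e0.
  exists ([set n | (N <= n)%N], setT).
    by split; [exists N | exact: filterT].
  move=> [i j] [/= Ni _]; apply: le_lt_trans (tail i j) _.
  apply: le_lt_trans Ne; apply: ler_wpM2r => //.
  by apply: ler_wiXn2l => //; apply: ltW.
pose l := lim (series u @ \oo); exists l.
have Sl : series u @ \oo --> l by [].
have gS : [sequence series u n.+1]_n - (fun n => g (series u n)) = cst y.
  apply/funext => n; rewrite !fctE /series /= big_nat_recl //.
  by rewrite -[g _]/(G _) raddf_sum /= addrK.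
have gl : (fun n => g (series u n)) @ \oo --> g l.
  apply/cvgrPdist_lt => e e0; near=> n.
  rewrite -gB; apply: le_lt_trans (gq _) _.
  apply: le_lt_trans (_ : 1 * `|l - series u n| < _).
    by apply: ler_wpM2r => //; apply: ltW.
  by rewrite mul1r; near: n; move/cvgrPdist_lt : Sl; apply.
have Sl1 : [sequence series u n.+1]_n @ \oo --> l by rewrite cvg_shiftS.
have yl : cst y @ \oo --> l - g l by rewrite -gS; apply: cvgB.
exact: cvg_unique yl (cvg_cst _).
Unshelve. all: by end_near. Qed.

(** Since [B D x = x - B (A x - D x)] is a small perturbation of the identity,
    the equation [B D x = B y] is solvable; [B] is injective. *)
Lemma perturbed_surjective {A B D : E -> E} {q : K} :
  zmod_morphism A -> zmod_morphism B -> zmod_morphism D ->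
  cancel A B -> cancel B A ->
  0 <= q -> q < 1 -> (forall x, `|B (A x - D x)| <= q * `|x|) ->
  forall y, exists x, D x = y.
Proof.
move=> AB BB DB AK BK q0 q1 bound y.
have gB : zmod_morphism (fun x => B (A x - D x)).
  by move=> x z; rewrite AB DB -BB; congr B; rewrite !opprD !opprK addrACA.
have [x] := neumann_surjective gB q0 q1 bound (B y).
by rewrite BB AK subKr => /(can_inj BK); exists x.
Qed.

End Neumann.

Lemma perturbed_expanding {K : numFieldType} {E : normedModType K}
    {A B D : E -> E} {q : K} :
  zmod_morphism B -> cancel A B -> (forall x, `|B (A x - D x)| <= q * `|x|) ->
  forall x, (1 - q) * `|x| <= `|B (D x)|.
Proof.
move=> BB AK bound x.
have -> : B (D x) = x - B (A x - D x) by rewrite BB AK subKr.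
apply: le_trans (lerB_dist _ _).
by rewrite mulrBl mul1r lerB.
Qed.

(** * Units and inverses *)

(** If [a e = a], then [e] is a right unit because every [y] has the form
    [z a]; symmetrically there is a left unit, and the two coincide. *)
Lemma unital_of_surjective_mul {T : Type} {op : T -> T -> T} {a : T} :
  associative op ->
  (forall y, exists x, op a x = y) -> (forall y, exists x, op x a = y) ->
  exists e b, [/\ left_id e op, right_id e op, op a b = e & op b a = e].
Proof.
move=> opA aT Ta; have [e ae] := aT a; have [e' ea] := Ta a.
have re : right_id e op by move=> y; have [z <-] := Ta y; rewrite -opA ae.
have le : left_id e' op by move=> y; have [z <-] := aT y; rewrite opA ea.
have ee : e = e' by rewrite -[LHS]le re.
subst e'; have [b ab] := aT e; have [b' ba] := Ta e.
have bb : b = b' by rewrite -[LHS]le -ba -opA ab re.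
by exists e, b; rewrite {2}bb.
Qed.

Section UnitsAndInverses.
Context {K : numFieldType} {E : completeNormedModType K}.
Implicit Types (m : E -> E -> E) (a e : E).

Lemma unit_ofP {m} : Mltp_u E m -> is_unit m (unit_of m).
Proof. by case=> _ eP; apply: (xgetPex 0 eP). Qed.

Lemma inv_ofP {m a} : Invertibles m a -> is_inverse m a (inv_of m a).
Proof. by move=> bP; apply: (xgetPex 0 bP). Qed.

Lemma is_unit_uniq {m e} : Mltp_u E m -> is_unit m e -> unit_of m = e.
Proof. by move=> /unit_ofP[le _] [_ re]; rewrite -[RHS]le re. Qed.

End UnitsAndInverses.

(** * Stability under perturbation of the multiplication *)

Section Stability.
Context {R : realType} {K : numFieldType} {iota : R -> K}.
Context {E : completeNormedModType K}.
Context {m d : E -> E -> E} {a : E} {mu al be de q : K}.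
Hypotheses (hK : real_or_complex iota).
Hypotheses (mM : Mltp_u E m) (ma : Invertibles m a) (dM : Mltp E d).
Hypotheses (m_mu : opnorm m <= mu) (a_al : `|a| <= al).
Hypotheses (b_be : `|inv_of m a| <= be) (dm_de : opnorm (d - m) <= de).
Hypothesis hq : mu * (be * (de * al)) <= q.

Let b := inv_of m a.
Let mB : B2 E m := mM.1.1.
Let dB : B2 E d := dM.1.
Let dmB : B2 E (d - m) := B2B hK dB mB.
Let mA : associative m := mM.1.2.

Lemma left_mulK : cancel (m a) (m b) /\ cancel (m b) (m a).
Proof.
have [ab ba] := inv_ofP ma; have [le re] := unit_ofP mM.
by split=> x; rewrite mA ?ab ?ba le.
Qed.

Lemma right_mulK : cancel (m^~ a) (m^~ b) /\ cancel (m^~ b) (m^~ a).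
Proof.
have [ab ba] := inv_ofP ma; have [le re] := unit_ofP mM.
by split=> x; rewrite -mA ?ab ?ba re.
Qed.

Lemma left_mul_perturbation x : `|m b (m a x - d a x)| <= q * `|x|.
Proof.
have h : `|m a x - d a x| <= de * (al * `|x|).
  by rewrite distrC; apply: (opnorm_le hK dmB dm_de a_al (lexx _)).
apply: le_trans (opnorm_le hK mB m_mu b_be h) _.
by rewrite !mulrA ler_wpM2r // -!mulrA.
Qed.

Lemma right_mul_perturbation x : `|m (m x a - d x a) b| <= q * `|x|.
Proof.
have h : `|m x a - d x a| <= de * (`|x| * al).
  by rewrite distrC; apply: (opnorm_le hK dmB dm_de (lexx _) a_al).
apply: le_trans (opnorm_le hK mB m_mu h b_be) _.
rewrite [_ * be]mulrC [`|x| * al]mulrC !mulrA.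
by rewrite ler_wpM2r // -!mulrA.
Qed.

(** The two bounds above say that left and right [d]-multiplication by [a] are
    small perturbations of invertible operators, hence surjective. *)
Lemma perturbed_invertible : q < 1 -> Mltp_u E d /\ Invertibles d a.
Proof.
move=> q1; have dA := dM.2.
have zl (f : E -> E -> E) (fB : B2 E f) y := zmod_morphism_linear (fB.1.1 y).
have zr (f : E -> E -> E) (fB : B2 E f) y := zmod_morphism_linear (fB.1.2 y).
have q0 : 0 <= q.
  apply: le_trans hq; rewrite !mulr_ge0 //.
  - exact: le_trans (opnorm_ge0 hK mB) m_mu.
  - exact: le_trans (normr_ge0 _) b_be.
  - exact: le_trans (opnorm_ge0 hK dmB) dm_de.
  - exact: le_trans (normr_ge0 _) a_al.
have [lK lK'] := left_mulK; have [rK rK'] := right_mulK.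
have aT := perturbed_surjective hK (zr m mB a) (zr m mB b)
  (zr d dB a) lK lK' q0 q1 left_mul_perturbation.
have Ta := perturbed_surjective hK (zl m mB a) (zl m mB b)
  (zl d dB a) rK rK' q0 q1 right_mul_perturbation.
have [e [c [le re ac ca]]] := unital_of_surjective_mul dA aT Ta.
have dU : Mltp_u E d by split=> //; exists e.
split=> //; exists c.
by rewrite /is_inverse (is_unit_uniq dU (conj le re)).
Qed.

Lemma left_mul_expanding {x c} : `|d a x| <= c -> (1 - q) * `|x| <= mu * (be * c).
Proof.
move=> dc; have [lK _] := left_mulK.
apply: le_trans (perturbed_expanding _ lK left_mul_perturbation x) _.
  exact: zmod_morphism_linear (mB.1.2 b).
exact: (opnorm_le hK mB m_mu b_be dc).
Qed.

(** The difference [x] of the units satisfies [d a x = a - d a e = m a e - d a e],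
    which is of the order of [d - m]. *)
Lemma unit_perturbation {ep} : q < 1 -> `|unit_of m| <= ep ->
  (1 - q) * `|unit_of d - unit_of m| <= mu * (be * (de * (al * ep))).
Proof.
move=> q1 e_ep; have [dU _] := perturbed_invertible q1.
have [_ rd] := unit_ofP dU; have [_ rm] := unit_ofP mM.
apply: left_mul_expanding.
rewrite (zmod_morphism_linear (dB.1.2 a)) rd -{1}[a]rm distrC.
exact: (opnorm_le hK dmB dm_de a_al e_ep).
Qed.

(** The difference [x] of the inverses satisfies
    [d a x = (e_d - e) + (m a b - d a b)], so the distance of the units enters
    the bound. *)
Lemma inv_perturbation {t} : q < 1 -> `|unit_of d - unit_of m| <= t ->
  (1 - q) * `|inv_of d a - inv_of m a| <= mu * (be * (t + de * (al * be))).
Proof.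
move=> q1 ht; have [dU da] := perturbed_invertible q1.
have [ab _] := inv_ofP ma; have [ab' _] := inv_ofP da.
apply: left_mul_expanding.
rewrite (zmod_morphism_linear (dB.1.2 a)) ab' -(subrK (unit_of m) (unit_of d)).
rewrite -addrA; apply: le_trans (ler_normD _ _) (lerD ht _).
rewrite -ab distrC; exact: (opnorm_le hK dmB dm_de a_al b_be).
Qed.

End Stability.

Theorem theorem2p4 (R : realType) :
  (forall (K : numFieldType) (iota : R -> K), real_or_complex iota ->
   forall (E : completeNormedModType K) (m : E -> E -> E) (a : E)
     (d : E -> E -> E),
     (exists x : E, x != 0) ->
     Mltp_u E m -> Invertibles m a -> Mltp E d ->
     opnorm (d - m) < (`|a| * `|inv_of m a| * opnorm m)^-1 ->
     Mltp_u E d /\ Invertibles d a)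
  /\
  (forall M : R, 0 < M ->
   exists C : R, 0 < C /\
   forall (K : numFieldType) (iota : R -> K), real_or_complex iota ->
   forall (E : completeNormedModType K) (m : E -> E -> E) (a : E)
     (d : E -> E -> E) (r : R),
     (exists x : E, x != 0) ->
     Mltp_u E m -> Invertibles m a -> Mltp E d ->
     0 <= r -> r < 1 ->
     opnorm m <= iota M -> `|unit_of m| <= iota M ->
     `|a| <= iota M -> `|inv_of m a| <= iota M ->
     opnorm (d - m) <= iota (r * M ^- 3) ->
     let s := 1 + r * (1 - r)^-1 in
     [/\ Mltp_u E d, Invertibles d a &
       `|inv_of d a - inv_of m a| <= iota (s ^+ 2 * C) * opnorm (d - m)]).
Proof.
split.
  move=> K iota hK E m a d _ mM ma dM dm_lt.
  have mB : B2 E m := mM.1.1.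
  have dmB := B2B hK dM.1 mB.
  have dm0 := opnorm_ge0 hK dmB.
  (* A vanishing product has inverse 0 and would make the hypothesis
     opnorm (d - m) < 0. *)
  have P0 : 0 < `|a| * `|inv_of m a| * opnorm m.
    by rewrite -invr_gt0; apply: le_lt_trans dm_lt.
  apply: (perturbed_invertible hK mM ma dM
    (lexx _) (lexx _) (lexx _) (lexx _) (lexx _)).
  rewrite -(ltr_pM2r P0) mulVf ?gt_eqF // in dm_lt.
  by congr (_ < 1) : dm_lt; ring.
(* The two powers are those of s M^2 (s M^4 + M^2), see inv_perturbation. *)
move=> M M0; exists (M ^+ 6 + M ^+ 4); split.
  by rewrite addr_gt0 ?exprn_gt0.
move=> K iota hK E m a d r _ mM ma dM r0 r1 m_M e_M a_M b_M dm_M s.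
have [f [iE fle _]] := real_or_complex_embedding hK.
have mB : B2 E m := mM.1.1.
have dmB := B2B hK dM.1 mB.
set de := opnorm (d - m) in dm_M *.
have de0 : 0 <= de := opnorm_ge0 hK dmB.
rewrite iE in m_M e_M a_M b_M dm_M *.
have N0 : 0 <= f M by rewrite -(rmorph0 f) fle ltW.
have q1 : f r < 1 by rewrite -(rmorph1 f) (leW_mono fle).
have hq : f M * (f M * (de * f M)) <= f r.
  have -> : f M * (f M * (de * f M)) = de * f (M ^+ 3).
    by rewrite rmorphXn !exprS expr0 mulr1 mulrC -!mulrA mulrCA.
  apply: le_trans (ler_wpM2r _ dm_M) _; first by rewrite rmorphXn exprn_ge0.
  by rewrite -rmorphM mulfVK // expf_neq0 // gt_eqF.
have [dU da] := perturbed_invertible hK mM ma dM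
  m_M a_M b_M (lexx de) hq q1.
split=> //.
have sE : s = (1 - r)^-1.
  rewrite /s -[X in X + _](@divff _ (1 - r)) ?subr_eq0 ?gt_eqF //.
  by rewrite -mulrDl subrK mul1r.
have s1 : 1 <= s by rewrite /s lerDl divr_ge0 // subr_ge0 ltW.
(* With s opaque, f s stays a single scalar when morphism laws are pushed in. *)
clearbody s.
have fs1 : 1 <= f s by rewrite -(rmorph1 f) fle.
have fsK x y : (1 - f r) * x <= y -> x <= f s * y.
  by rewrite sE fmorphV rmorphB rmorph1 -ler_pdivlMl ?invrK ?invr_gt0 ?subr_gt0.
have := unit_perturbation hK mM ma dM m_M a_M b_M (lexx de) hq q1 e_M.
move=> /fsK ht.
have := inv_perturbation hK mM ma dM m_M a_M b_M (lexx de) hq q1 ht.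
move=> /fsK /le_trans; apply.
rewrite !(rmorphM, rmorphD, rmorphXn) /=; move: (f s) (f M) fs1 N0 => S N S1 N0.
have S0 : 0 <= S := le_trans ler01 S1.
(* The difference of the two sides consists of the terms in N^4, for which
   S <= S^2. *)
rewrite -subr_ge0.
have -> : S ^+ 2 * (N ^+ 6 + N ^+ 4) * de - S * (N * (N *
  (S * (N * (N * (de * (N * N)))) + de * (N * N)))) = (S - 1) * S * N ^+ 4 * de.
  by ring.
by rewrite !mulr_ge0 ?exprn_ge0 // subr_ge0.
Qed.
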